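(* Let $k$ be an odd integer with $k\ge 3$, and let $G$ be a finite simple $k$-regular graph (not assumed to be connected). Then $G$ is antimagic; that is, writing $m=|E(G)|$, there exists a bijection $f:E(G)\to\{1,2,\ldots,m\}$ such that for all distinct vertices $u,v\in V(G)$, $$\sum_{e\in E(u)}f(e)\neq\sum_{e\in E(v)}f(e),$$ where $E(x)$ denotes the set of edges of $G$ incident to the vertex $x$.
   Context: Graphs are finite, undirected and simple (no loops, no parallel edges). A labeling of a graph $G$ with $m$ edges is a bijection from $E(G)$ to $\{1,2,\ldots,m\}$. Given a labeling, the vertex sum at a vertex $v$ is the sum of the labels on the edges incident to $v$. A labeling is antimagic if all its vertex sums are pairwise different, and a graph is antimagic if it has an antimagic labeling. *)

(* Defs.v *)
From mathcomp Require Import all_boot.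

Set Implicit Arguments.
Unset Strict Implicit.
Unset Printing Implicit Defensive.

(* A finite simple graph is a symmetric irreflexive relation [e] on a finType
   [T] of vertices; each undirected edge is the 2-element set of its ends. *)
Definition edges (T : finType) (e : rel T) : {set {set T}} :=
  [set [set p.1; p.2] | p : T * T & e p.1 p.2].

Definition incident_edges (T : finType) (e : rel T) (x : T) : {set {set T}} :=
  [set a in edges e | x \in a].

Definition regular (T : finType) (e : rel T) (k : nat) : Prop :=
  forall x : T, #|[set y | e x y]| = k.

(* [f] restricts to a bijection from the edge set onto {1, ..., m}, where m is
   the number of edges; the values of [f] off the edge set are irrelevant. *)
Definition labeling (T : finType) (e : rel T) (f : {set T} -> nat) : Prop :=
  {in edges e &, injective f} /\
  (forall j : nat,
     (exists2 a : {set T}, a \in edges e & f a = j) <-> 1 <= j <= #|edges e|).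

Definition vertex_sum (T : finType) (e : rel T) (f : {set T} -> nat) (x : T)
  : nat := \sum_(a in incident_edges e x) f a.

Definition antimagic (T : finType) (e : rel T) : Prop :=
  exists f : {set T} -> nat,
    labeling e f /\
    (forall u v : T, u <> v -> vertex_sum e f u <> vertex_sum e f v).

(* Main.v *)
Require Import Defs.
From mathcomp Require Import all_boot.
From mathcomp Require Import zify.

Set Implicit Arguments.
Unset Strict Implicit.
Unset Printing Implicit Defensive.

(* After Cranston, Liang and Zhu.  Let k = K + 1.  The edges are labelled level
   by level towards a root: if A is the set of vertices still to be treated and
   U is the level adjacent to it, one labels first the edges inside U, then the
   edges between U and A except one chosen edge at each u in U, and last the
   chosen edges, in the order of the partial sums at their ends in U, so that
   the sums on U become distinct.  To make all sums on A exceed those on U, the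
   other edges between U and A are split into open trails labelled alternately
   with the smallest and the largest free labels: consecutive edges then have
   at most the average sum at vertices of U and at least that at vertices of A.
   Since K is even, the unpaired edges at a vertex can be paired with edges
   outside this block.  A closed trail without free vertices is opened by
   exchanging a chosen edge with one of its edges. *)


(** * Positions of edges in a sequence, and their arithmetic *)

Lemma low_side_arith h d p q q' (A B : bool) (d0 : h = 0 -> d = 0 /\ p = 0)
 (h1 : 2 * p <= (d + q') * h.-1) (h2 : q' + B <= q + A) :
 2 * (p + B * h + (d + B)) <= (A + (d + B) + q) * h.+1.
Proof.
apply: (@leq_trans ((d + q' + B.*2) * h.+1)); last by rewrite leq_mul2r; lia.
case: h h1 d0 => [|h] h1 d0; first by case: d0 => // -> ->; lia.
by move: h1 {d0 h2}; rewrite /= -!muln2 !mulnDl; case: B; lia.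
Qed.

Lemma high_side_arith h d p q q' (A B : bool) (d0 : h = 0 -> d = 0 /\ p = 0)
 (h1 : d * h.-1 <= q' * h.-1 + 2 * p) (h2 : q' + A <= q + B) :
 (A + (d + B)) * h.+1 <= q * h.+1 + 2 * (p + B * h + (d + B)).
Proof.
have h3 : (q' + A + B) * h.+1 <= (q + B.*2) * h.+1 by rewrite leq_mul2r; lia.
apply: (@leq_trans ((q' + A + B) * h.+1 + 2 * (p + d))).
  case: h h1 d0 {h2 h3} => [|h] h1 d0; first by case: d0 => // -> ->; lia.
  by move: h1 {d0}; rewrite /= !mulnDl; case: A; case: B; lia.
move: h3 {d0 h1 h2}; rewrite -!muln2 !mulnDl; case: A; case: B; lia.
Qed.

Section Positions.
Variable T : finType.
Implicit Types (x : T) (a b : {set T}) (s : seq {set T}).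

Definition degree_in s x := count (fun a : {set T} => x \in a) s.

Definition position_sum s x := \sum_(a <- s | x \in a) index a s.

Lemma position_sum_cons a s x : a \notin s ->
  position_sum (a :: s) x = position_sum s x + degree_in s x.
Proof.
move=> as'; rewrite /position_sum big_cons /= eqxx add0n /degree_in -sum1_count.
have -> : \sum_(b <- s | x \in b) (if a == b then 0 else (index b s).+1) =
          \sum_(b <- s | x \in b) (index b s + 1).
  rewrite big_seq_cond [RHS]big_seq_cond; apply: eq_bigr => b /andP[bs _].
  by case: eqP => [ab|_]; [rewrite ab bs in as' | rewrite addn1].
by rewrite big_split; case: ifP; rewrite ?add0n.
Qed.

Lemma position_sum_rcons a s x : a \notin s ->
  position_sum (rcons s a) x = position_sum s x + (x \in a) * size s.
Proof.
move=> as'; rewrite /position_sum -cats1 big_cat /= big_cons big_nil addn0.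
congr (_ + _).
  rewrite big_seq_cond [RHS]big_seq_cond; apply: eq_bigr => b /andP[bs _].
  by rewrite index_cat bs.
by rewrite index_cat (negbTE as') /= eqxx addn0; case: (x \in a); rewrite ?mul1n.
Qed.

End Positions.

(** * Balanced orders obtained from edge-disjoint trails *)

Section Ordering.
Variables (T : finType) (U : {set T}).
Implicit Types (x : T) (a b : {set T}) (s : seq {set T}) (q : T -> nat).
Implicit Types (t : T * seq T) (P : seq (T * seq T)).

(* With [h] edges in [s], two paired edges have positions summing to at most
   [h - 1] at a vertex of [U] and to at least [h - 1] elsewhere; [q x] bounds
   the number of unpaired edges at [x]. *)
Definition balanced q s := forall x,
  if x \in U
  then 2 * position_sum s x <= (degree_in s x + q x) * (size s).-1
  else degree_in s x * (size s).-1 <= q x * (size s).-1 + 2 * position_sum s x.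

(** With [h] edges in [s], the target for a pair grows from [h - 1] to [h + 1]. Pairs inside [s]
    keep up, since each of their positions shifts by one, and [a], [b] have positions 0 and [h + 1].
    A low position is good in [U] and a high one elsewhere, so a badly placed edge at [x] has to be
    offset by a well placed one or by a drop from [q x] to [q' x]. *)
Lemma balanced_extend q q' s a b : uniq (a :: rcons s b) -> balanced q' s ->
  (forall x, if x \in U then q' x + (x \in b) <= q x + (x \in a)
             else q' x + (x \in a) <= q x + (x \in b)) ->
  balanced q (a :: rcons s b).
Proof.
rewrite cons_uniq rcons_uniq => /andP[an /andP[bn us]] bs qq x.
have dr : degree_in (rcons s b) x = degree_in s x + (x \in b).
  by rewrite /degree_in -cats1 count_cat /= addn0.
rewrite position_sum_cons // position_sum_rcons // dr.
have -> : degree_in (a :: rcons s b) x = (x \in a) + (degree_in s x + (x \in b)).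
  by rewrite -dr.
rewrite /= size_rcons.
(* In the arithmetic lemmas [h], [d], [p] stand for the size, degree and position sum of [s] at [x],
   and the booleans [A], [B] tell whether [x] lies on [a], [b]. *)
move: (bs x) (qq x).
have d0 : size s = 0 -> degree_in s x = 0 /\ position_sum s x = 0.
  by case: (s) => // _; split => //; rewrite /position_sum big_nil.
case: (x \in U) => h1 h2.
  exact: low_side_arith d0 h1 h2.
exact: high_side_arith d0 h1 h2.
Qed.

(* The pair [(x, z)] stands for the walk through the vertices [x :: z]. *)
Definition trail_edges t := pairmap (fun x y => [set x; y]) t.1 t.2.
Definition all_edges P := flatten [seq trail_edges t | t <- P].
(** A closed trail, even one without edges, counts twice at its base vertex. *)
Definition trail_ends t x := (t.1 == x) + (last t.1 t.2 == x).
Definition all_ends P x := \sum_(t <- P) trail_ends t x.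

(** Taking [x = y] shows that a crossing set is never a singleton, so loops are excluded too. *)
Definition crossing a := forall x y, a = [set x; y] -> (x \in U) = ~~ (y \in U).

Lemma all_edges_cons t P : all_edges (t :: P) = trail_edges t ++ all_edges P.
Proof. by []. Qed.

Lemma all_ends_cons t P x : all_ends (t :: P) x = trail_ends t x + all_ends P x.
Proof. by rewrite /all_ends big_cons. Qed.

Lemma all_edges_perm P P' : perm_eq P P' -> perm_eq (all_edges P) (all_edges P').
Proof. by move=> PP'; apply: perm_flatten; apply: perm_map. Qed.

Lemma all_ends_perm P P' x : perm_eq P P' -> all_ends P x = all_ends P' x.
Proof. by move=> PP'; apply: perm_big. Qed.

Ltac ends_lia :=
  repeat match goal with |- context [?a == ?b] =>
    let c := fresh in set c := (a == b); move: (c); clear c => c end;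
  repeat match goal with |- context [all_ends ?P ?p] =>
    let c := fresh in set c := (all_ends P p); move: (c); clear c => c end;
  clear; lia.

(** Induction on the number of edges: two edges are removed from the trails and placed around an
    order of the rest, one first and one last. Consecutive edges of a trail are paired at their
    common vertex; once all trails have at most one edge, trail ends pay for every badly placed
    edge. *)
Lemma balanced_order P : uniq (all_edges P) ->
  (forall a, a \in all_edges P -> crossing a) ->
  exists2 s, perm_eq s (all_edges P) & balanced (all_ends P) s.
Proof.
have [n] := ubnP (size (all_edges P)); elim: n P => // n IH P /ltnSE szP uP crP.
have transfer P' : perm_eq P P' ->
    (exists2 s, perm_eq s (all_edges P') & balanced (all_ends P') s) ->
    exists2 s, perm_eq s (all_edges P) & balanced (all_ends P) s.
  move=> PP' [s sP' bs]; exists s.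
    by rewrite (perm_trans sP') // perm_sym all_edges_perm.
  by move=> x; move: (bs x); rewrite (all_ends_perm x PP').
have [/hasP[[x [//|y [//|z r]]] tP _]|nolong] := boolP (has (fun t => 1 < size t.2) P).
  have PP' := perm_to_rem tP; set P' := rem _ P in PP'.
  apply: (transfer _ PP').
  have eP := all_edges_perm PP'; rewrite all_edges_cons /= in eP.
  have uP' : uniq ([set x; y] :: [set y; z] :: all_edges ((z, r) :: P')).
    by rewrite -(perm_uniq eP).
  have crP' a : a \in [set x; y] :: [set y; z] :: all_edges ((z, r) :: P') -> crossing a.
    by rewrite -(perm_mem eP); apply: crP.
  have [|||s sE bs] := IH ((z, r) :: P').
  - by move: szP; rewrite (perm_size eP) /=; apply: leq_trans.
  - by move: uP' => /= /andP[_ /andP[]].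
  - by move=> a aP; apply: crP'; rewrite !inE aP !orbT.
  have xy := crP' _ (mem_head _ _) x y erefl.
  have yz : (y \in U) = ~~ (z \in U) by apply: crP' erefl; rewrite !inE eqxx orbT.
  have us a b : perm_eq [:: a; b] [:: [set x; y]; [set y; z]] ->
      perm_eq (a :: rcons s b) (all_edges ((x, y :: z :: r) :: P')).
    move=> ab; rewrite all_edges_cons /=.
    have := perm_cat ab sE; apply: perm_trans.
    by rewrite /= perm_cons -cats1 -cat1s perm_sym -cat1s perm_catC.
  have key a b : perm_eq [:: a; b] [:: [set x; y]; [set y; z]] ->
    (forall p, if p \in U
       then all_ends ((z, r) :: P') p + (p \in b) <=
            all_ends ((x, y :: z :: r) :: P') p + (p \in a)
       else all_ends ((z, r) :: P') p + (p \in a) <=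
            all_ends ((x, y :: z :: r) :: P') p + (p \in b)) ->
     exists2 s0, perm_eq s0 (all_edges ((x, y :: z :: r) :: P')) &
     balanced (all_ends ((x, y :: z :: r) :: P')) s0.
    move=> ab qq; exists (a :: rcons s b); first exact: us.
    by apply: balanced_extend bs qq; rewrite (perm_uniq (us _ _ ab)).
  (* The vertices [x] and [z] lie on the same side of [U]. The edge at [x] is placed badly, paid for
     by the end that disappears at [x]; the edge at [z] is placed well, which makes up for the new
     end at [z]. *)
  case xU: (x \in U).
  - apply: (key [set y; z] [set x; y]) => [|p]; first by rewrite (perm_catC [:: _]).
    rewrite !all_ends_cons /trail_ends /= !inE.
    case: ifP => pU.
      have -> : p == y = false.
        by apply: contraTF pU => /eqP->; rewrite xU in xy; case: (y \in U) xy.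
      by rewrite !orbF ![_ == p]eq_sym; ends_lia.
    have xpF : x == p = false by apply: contraFF pU => /eqP<-.
    have zpF : z == p = false.
      apply: contraFF pU => /eqP<-; move: yz xy; rewrite xU.
      by case: (y \in U) => //; case: (z \in U).
    rewrite xpF zpF.
    by rewrite ![p == _]eq_sym xpF zpF; ends_lia.
  - apply: (key [set x; y] [set y; z]) => // p.
    rewrite !all_ends_cons /trail_ends /= !inE.
    have yU : y \in U by rewrite xU in xy; case: (y \in U) xy.
    have zU : z \in U = false by move: yz; rewrite yU; case: (z \in U).
    case: ifP => pU.
      have -> : x == p = false by apply: contraTF pU => /eqP<-; rewrite xU.
      have -> : z == p = false by apply: contraTF pU => /eqP<-; rewrite zU.
      have -> : p == x = false by apply: contraTF pU => /eqP->; rewrite xU.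
      have -> : p == z = false by apply: contraTF pU => /eqP->; rewrite zU.
      by ends_lia.
    have -> : p == y = false by apply: contraFF pU => /eqP->.
    by rewrite !orbF ![_ == p]eq_sym; ends_lia.
have short t : t \in P -> size t.2 <= 1.
  by move=> tP; rewrite leqNgt; apply: (hasPn nolong).
have single P' : {subset P' <= P} ->
    (exists x y, (x, [:: y]) \in P') \/ all_edges P' = [::].
  elim: P' => [|[x z] P' IHP] sP; first by right.
  have [|[x' [y' xy]]|E] := IHP; first by move=> t tP; apply: sP; rewrite inE tP orbT.
    by left; exists x', y'; rewrite inE xy orbT.
  have := short _ (sP _ (mem_head _ _)).
  case: z {sP} => [|y [|//]] _; first by right.
  by left; exists x, y; rewrite mem_head.
have [//|[x [y tP]]|->] := single P; last first.
  by exists [::] => // p; rewrite /= muln0 /position_sum big_nil; case: ifP.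
have PP' := perm_to_rem tP; set P' := rem _ P in PP'.
  apply: (transfer _ PP').
  have [t tP'|[x' [y' tP']]|E] := single P'; first exact: mem_rem tP'.
  (* Two single edges: all four of their ends disappear, so either order is paid for. *)
  + have PP'' := perm_to_rem tP'; set P'' := rem _ P' in PP''.
    have pp : perm_eq P ((x, [:: y]) :: (x', [:: y']) :: P'').
      by rewrite (perm_trans PP') // perm_cons.
    have eP := all_edges_perm pp; rewrite !all_edges_cons /= in eP.
    have [|||s sE bs] := IH P''.
    * by move: szP; rewrite (perm_size eP) /=; lia.
    * by move: uP; rewrite (perm_uniq eP) /= => /andP[_ /andP[]].
    * by move=> a aP; apply: crP; rewrite (perm_mem eP) !inE aP !orbT.
    have us : perm_eq ([set x; y] :: rcons s [set x'; y']) (all_edges ((x, [:: y]) :: P')).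
      rewrite all_edges_cons /= perm_cons perm_rcons.
      apply: perm_trans (_ : perm_eq _ (all_edges ((x', [:: y']) :: P''))) _.
        by rewrite all_edges_cons /= perm_cons.
      by rewrite perm_sym all_edges_perm.
    exists ([set x; y] :: rcons s [set x'; y']); first exact: us.
    apply: balanced_extend bs _ => [|p].
      by rewrite (perm_uniq us) -(perm_uniq (all_edges_perm PP')).
    rewrite all_ends_cons (all_ends_perm p PP'') all_ends_cons /trail_ends /= !inE.
    by rewrite ![_ == p]eq_sym; case: ifP => _; ends_lia.
  (* A lone edge has position 0, and the target is 0 as well. *)
  + rewrite all_edges_cons E.
    exists [:: [set x; y]] => // p.
    by rewrite /= !muln0 /position_sum big_cons big_nil /= eqxx; do 2 case: ifP.
Qed.

End Ordering.

(** * Parity, reversal and rotation of trails; degrees in edge sets *)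

Section Trails.
Variables (T : finType) (U : {set T}).
Implicit Types (x y u v w : T) (z : seq T) (a b : {set T}).
Implicit Types (S : {set {set T}}) (s : seq {set T}).
Implicit Types (t : T * seq T) (P : seq (T * seq T)).

Lemma trail_edges_cat x z1 z2 :
  trail_edges (x, z1 ++ z2) = trail_edges (x, z1) ++ trail_edges (last x z1, z2).
Proof. exact: pairmap_cat. Qed.

Lemma trail_edges_rev x z :
  perm_eq (trail_edges (last x z, rev (belast x z))) (trail_edges (x, z)).
Proof.
elim: z x => [|y z IH] x //=.
rewrite rev_cons -cats1 trail_edges_cat perm_catC /=.
have -> : last (last y z) (rev (belast y z)) = y.
  by case: (z) => //= y' z'; rewrite rev_cons last_rcons.
by rewrite setUC perm_cons.
Qed.

(** Each passage through [y] uses two edges, so only the ends affect the parity. Crossing edges are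
    not loops, which would be counted once only. *)
Lemma trail_edges_degree_odd t y : (forall a, a \in trail_edges t -> crossing U a) ->
  odd (degree_in (trail_edges t) y) = odd (trail_ends t y).
Proof.
case: t => x z; elim: z x => [|x' z IH] x cr /=.
  by rewrite /trail_ends /= addnn odd_double.
have crz a : a \in trail_edges (x', z) -> crossing U a.
  by move=> aE; apply: cr; rewrite inE aE orbT.
have := IH x' crz.
rewrite /trail_ends /= !oddD => ->; rewrite !inE.
have : x != x'.
  apply/eqP => xx; have := cr _ (mem_head _ _) x x' erefl.
  by rewrite xx; case: (_ \in U).
rewrite ![y == _]eq_sym; case: (x =P y) => [->|_]; case: (x' =P y) => [->|_] //=.
  by rewrite eqxx.
by rewrite negbK.
Qed.

Lemma all_edges_degree_odd P y : (forall a, a \in all_edges P -> crossing U a) ->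
  odd (degree_in (all_edges P) y) = odd (all_ends P y).
Proof.
elim: P => [|t P IH] cr; first by rewrite /all_ends big_nil.
rewrite all_ends_cons all_edges_cons /degree_in count_cat !(oddD (count _ _)).
rewrite (oddD (trail_ends t y)) -trail_edges_degree_odd -?IH // => a aP; apply: cr.
  by rewrite all_edges_cons mem_cat aP orbT.
by rewrite all_edges_cons mem_cat aP.
Qed.

Lemma all_ends_gt0 P w : 0 < all_ends P w ->
  exists2 t, t \in P & 0 < trail_ends t w.
Proof.
elim: P => [|t P IH]; first by rewrite /all_ends big_nil.
rewrite all_ends_cons addn_gt0 => /orP[tw|/IH[t' tP tw]].
  by exists t; rewrite ?mem_head.
by exists t'; rewrite // inE tP orbT.
Qed.

(** A trail that ends at [w] can be reversed without changing its edges or its ends. This lets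
    another trail be continued through [w]. *)
Lemma orient_trail P w : 0 < all_ends P w ->
  exists l P', perm_eq (all_edges ((w, l) :: P')) (all_edges P) /\
               all_ends ((w, l) :: P') =1 all_ends P.
Proof.
case/all_ends_gt0=> [[x z] tP]; have PP' := perm_to_rem tP.
set P' := rem _ P in PP'.
rewrite /trail_ends /= addn_gt0 !lt0b => /orP[]/eqP E.
  exists z, P'; rewrite -E; split=> [|p]; last exact/esym/all_ends_perm.
  by rewrite perm_sym all_edges_perm.
exists (rev (belast x z)), P'; rewrite -E; split => [|p].
  rewrite perm_sym (perm_trans (all_edges_perm PP')) // !all_edges_cons.
  by rewrite perm_cat2r perm_sym trail_edges_rev.
rewrite (all_ends_perm p PP') !all_ends_cons; congr (_ + _).
rewrite /trail_ends /= [RHS]addnC.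
suff -> : last (last x z) (rev (belast x z)) = x by [].
by case: (z) => //= y' z'; rewrite rev_cons last_rcons.
Qed.

Lemma rotate_closed_trail x z y : last x z = x -> y \in z ->
  exists z', [/\ last y z' = y, perm_eq z' z &
                 perm_eq (trail_edges (y, z')) (trail_edges (x, z))].
Proof.
move=> lz yz; case/splitPr: z / yz lz => z1 z2; rewrite last_cat /= => lz.
exists (z2 ++ rcons z1 y); split.
- by rewrite last_cat last_rcons.
- by rewrite -cat_rcons perm_catC.
- rewrite (trail_edges_cat y z2) lz perm_catC -(cat_rcons y z1 z2).
  by rewrite (trail_edges_cat x (rcons z1 y)) last_rcons.
Qed.

Definition dg (S : {set {set T}}) x := \sum_(a in S) (x \in a : nat).

Lemma dg_setU1 S a x : a \notin S -> dg (a |: S) x = (x \in a) + dg S x.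
Proof. by move=> aS; rewrite /dg big_setU1. Qed.

Lemma dg_setD1 S a x : a \in S -> dg S x = (x \in a) + dg (S :\ a) x.
Proof. by move=> aS; rewrite /dg (big_setD1 a). Qed.

Lemma dg_subset S S' x : S \subset S' -> dg S x <= dg S' x.
Proof.
by move=> /setIidPr SS; rewrite /dg (big_setID (A := S') S) /= SS leq_addr.
Qed.

Lemma degree_in_dg s x : uniq s -> degree_in s x = \sum_(a in s) (x \in a : nat).
Proof.
move=> us; by rewrite /degree_in -sum1_count big_mkcond /= -big_uniq //.
Qed.

Lemma degree_in_subset s S x : uniq s -> {subset s <= S} ->
  dg S x = degree_in s x + dg [set a in S | a \notin s] x.
Proof.
move=> us sS; rewrite degree_in_dg // /dg (bigID (mem s)) /=; congr (_ + _).
  by apply: eq_bigl => a; rewrite andb_idl //; apply: sS.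
by apply: eq_bigl => a; rewrite inE.
Qed.

End Trails.

Ltac degree_lia :=
  repeat match goal with |- context [?a == ?b] =>
    let c := fresh in set c := (a == b); move: (c); clear c => c end;
  repeat match goal with |- context [?a \in ?b] =>
    let c := fresh in set c := (a \in b); move: (c); clear c => c end;
  repeat match goal with |- context [all_ends ?P ?p] =>
    let c := fresh in set c := (all_ends P p); move: (c); clear c => c end;
  repeat match goal with |- context [dg ?P ?p] =>
    let c := fresh in set c := (dg P p); move: (c); clear c => c end;
  clear; lia.

(** * Edges and degrees of a symmetric irreflexive relation *)

Section Edges.
Variables (T : finType) (c : rel T).
Hypotheses (c_sym : symmetric c) (c_irr : irreflexive c).
Implicit Types (x y : T) (a : {set T}).

Lemma edgesP a : reflect (exists x y, c x y /\ a = [set x; y]) (a \in edges c).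
Proof.
apply: (iffP imsetP) => [[[x y]]|[x [y [cxy ->]]]].
  by rewrite inE /= => cxy ->; exists x, y.
by exists (x, y); rewrite ?inE.
Qed.

Lemma set2_inj_l x y y' : x != y -> [set x; y] = [set x; y'] -> y = y'.
Proof.
move=> xy E; have : y \in [set x; y'] by rewrite -E !inE eqxx orbT.
by rewrite !inE eq_sym (negbTE xy) => /eqP.
Qed.

Lemma edge_end a x : a \in edges c -> x \in a -> exists2 y, c x y & a = [set x; y].
Proof.
case/edgesP=> x1 [x2 [cx ->]]; rewrite !inE => /orP[]/eqP ->; first by exists x2.
by exists x1; rewrite 1?c_sym // setUC.
Qed.

Lemma mem_edges x y : ([set x; y] \in edges c) = c x y.
Proof.
apply/idP/idP => [xyE|cxy]; last by apply/edgesP; exists x, y.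
have [y' cxy' E] := edge_end xyE (set21 x y).
suff -> : y = y' by [].
apply/esym; apply: (@set2_inj_l x) => //.
by apply: contraTneq cxy' => ->; rewrite c_irr.
Qed.

Lemma dg_edges x : dg (edges c) x = #|[set y | c x y]|.
Proof.
rewrite /dg -[RHS](card_in_imset (f := fun y => [set x; y])); last first.
  move=> y y'; rewrite !inE => cxy _; apply: set2_inj_l.
  by apply: contraTneq cxy => ->; rewrite c_irr.
rewrite -sum1_card big_mkcond [RHS]big_mkcond /=; apply: eq_bigr => a _.
case: ifP => aE; case: imsetP => [[y]|H] //.
- by rewrite inE => cxy ->; rewrite !inE eqxx.
- case xa: (x \in a) => //; case: H.
  by have [y cxy ->] := edge_end aE xa; exists y; rewrite ?inE.
- by rewrite inE => cxy E; rewrite E mem_edges cxy in aE.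
Qed.

End Edges.

(** * Covering the unchosen edges of a bipartite graph by trails *)

Section Bipartite.
Variables (T : finType) (c : rel T) (U : {set T}) (K : nat).
Hypothesis c_sym : symmetric c.
Hypothesis cU : forall x y, c x y -> (x \in U) = ~~ (y \in U).
Implicit Types (x y u v w : T) (z : seq T) (a b : {set T}).
Implicit Types (t : T * seq T) (P : seq (T * seq T)) (sg : T -> T).

Lemma bip_irr x : c x x = false.
Proof. by apply/negP => /cU; case: (x \in U). Qed.

Let mem_bip := mem_edges c_sym bip_irr.
Let dg_bip := dg_edges c_sym bip_irr.

Lemma edges_crossing a : a \in edges c -> crossing U a.
Proof. by move=> aE x y E; move: aE; rewrite E mem_bip; apply: cU. Qed.

Lemma longest_trail (R : {set {set T}}) x : R \subset edges c ->
  exists z, [/\ uniq (trail_edges (x, z)), {subset trail_edges (x, z) <= R} &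
    forall a, a \in R -> last x z \in a -> a \in trail_edges (x, z)].
Proof.
move=> Rc.
suff: forall n z, #|R| - size z < n -> uniq (trail_edges (x, z)) ->
    {subset trail_edges (x, z) <= R} ->
    exists z, [/\ uniq (trail_edges (x, z)), {subset trail_edges (x, z) <= R} &
      forall a, a \in R -> last x z \in a -> a \in trail_edges (x, z)].
  by move=> /(_ _ [::] (ltnSn _)); apply.
elim=> // n IH z szn uz sz.
have [/existsP[a /and3P[aR la az]]|H] :=
  boolP [exists a, [&& a \in R, last x z \in a & a \notin trail_edges (x, z)]].
  have [y cy E] := edge_end c_sym (subsetP Rc _ aR) la.
  have Ez : trail_edges (x, rcons z y) = rcons (trail_edges (x, z)) a.
    by rewrite E -!cats1 trail_edges_cat.
  apply: (IH (rcons z y)).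
  - rewrite size_rcons; suff : size z < #|R| by lia.
    have : uniq (rcons (trail_edges (x, z)) a) by rewrite rcons_uniq az.
    move=> /card_uniqP; rewrite size_rcons size_pairmap => <-.
    apply: subset_leq_card; apply/subsetP => b.
    by rewrite mem_rcons inE => /orP[/eqP -> //|/sz].
  - by rewrite Ez rcons_uniq az.
  - by move=> b; rewrite Ez mem_rcons inE => /orP[/eqP -> //|/sz].
exists z; split => // a aR la; apply: contraNT H => az.
by apply/existsP; exists a; rewrite aR la.
Qed.

Definition unchosen sg := edges c :\: [set [set u; sg u] | u in U].

(** In the intended use a vertex has [K] edges besides one set aside. The last clause reserves, for
    every trail end at [x], one of these [K] edges outside the block of unchosen edges. *)
Definition partial_trails sg P :=
  [/\ forall u, u \in U -> c u (sg u), uniq (all_edges P),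
      {subset all_edges P <= unchosen sg} &
      forall x, all_ends P x + dg (unchosen sg) x <= K].

Hypothesis K_even : ~~ odd K.
Hypothesis degU : forall u, u \in U -> 0 < #|[set y | c u y]| <= K.+1.
Hypothesis degW : forall v, v \notin U -> #|[set y | c v y]| <= K.

Lemma unchosen_edges sg : unchosen sg \subset edges c.
Proof. exact: subsetDl. Qed.

Lemma dg_unchosen sg u x : u \in U -> c u (sg u) -> x \in [set u; sg u] ->
  dg (unchosen sg) x < dg (edges c) x.
Proof.
move=> uU cu xa; rewrite (@dg_setD1 _ (edges c) [set u; sg u]) ?mem_bip //.
rewrite xa add1n ltnS; apply: dg_subset; apply: setDS.
by rewrite sub1set; apply: imset_f.
Qed.

Lemma extend_partial_trails sg P t : partial_trails sg P -> 0 < size t.2 ->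
  uniq (trail_edges t) -> {subset trail_edges t <= unchosen sg} ->
  (forall a, a \in trail_edges t -> a \notin all_edges P) ->
  (forall x, 0 < trail_ends t x ->
     trail_ends t x + (all_ends P x + dg (unchosen sg) x) <= K) ->
  exists P', partial_trails sg P' /\ size (all_edges P) < size (all_edges P').
Proof.
move=> [sgc uP sP eP] t0 ut st tP et; exists (t :: P); split; last first.
  by rewrite all_edges_cons size_cat size_pairmap -[X in X < _]add0n ltn_add2r.
split=> //.
- rewrite all_edges_cons cat_uniq ut uP andbT /=.
  by apply/hasPn => a aP; apply/negP => /tP; rewrite aP.
- by move=> a; rewrite all_edges_cons mem_cat => /orP[/st|/sP].
- move=> x; rewrite all_ends_cons -addnA; have := et x.
  by case: (posnP (trail_ends t x)) => [->|_]; [rewrite add0n | apply].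
Qed.

(** * Enlarging a system of trails that leaves edges uncovered *)

Section Improve.
Variables (sg : T -> T) (P : seq (T * seq T)).
Hypothesis valid : partial_trails sg P.
Let R := [set a in unchosen sg | a \notin all_edges P].

Let R_edges : R \subset edges c.
Proof. by apply/subsetP => a; rewrite inE => /andP[/(subsetP (unchosen_edges sg))]. Qed.

Let R_unchosen : {subset R <= unchosen sg}.
Proof. by move=> a; rewrite inE => /andP[]. Qed.

Let R_notin a : a \in R -> a \notin all_edges P.
Proof. by rewrite inE => /andP[]. Qed.

(** The covered edges at [x] have the parity of the trail ends at [x]. *)
Lemma odd_rest x : odd (dg R x) = odd (all_ends P x + dg (unchosen sg) x).
Proof.
case: valid => _ uP sP _.
rewrite (degree_in_subset x uP sP) oddD oddD -(@all_edges_degree_odd _ U P x); last first.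
  by move=> a /sP /(subsetP (unchosen_edges sg)) /edges_crossing.
by rewrite addbA addbb.
Qed.

(** All edges of [R] at the last vertex lie on the trail, so their parity is that of the ends there:
    one end if the trail is open, two if it is closed. *)
Lemma stuck_degree x z : uniq (trail_edges (x, z)) -> {subset trail_edges (x, z) <= R} ->
  (forall a, a \in R -> last x z \in a -> a \in trail_edges (x, z)) ->
  odd (dg R (last x z)) = (last x z != x).
Proof.
move=> uz sz stuck; rewrite (degree_in_subset _ uz sz) [X in _ + X](_ : _ = 0).
  rewrite addn0 (@trail_edges_degree_odd _ U).
    by rewrite /trail_ends /= eqxx eq_sym; case: eqP.
  by move=> a /sz /(subsetP R_edges) /edges_crossing.
apply: big1 => a; rewrite inE => /andP[aR az]; apply/eqP; rewrite eqb0.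
by apply: contra az; apply: stuck.
Qed.

(** A maximal trail from an odd vertex stops at a different odd vertex. By [odd_rest] the load
    bounded by [K] is odd at both, hence below the even number [K], and each has room for one more
    end. *)
Lemma improve_odd x : odd (dg R x) ->
  exists P', partial_trails sg P' /\ size (all_edges P) < size (all_edges P').
Proof.
move=> oddx; have [z [uz sz stuck]] := longest_trail x R_edges.
have oddy := stuck_degree uz sz stuck.
have yx : last x z != x.
  by apply/eqP => E; move: oddy; rewrite E oddx eqxx.
apply: (@extend_partial_trails _ _ (x, z)) => //.
- by case: (z) yx => //=; rewrite eqxx.
- by move=> a /sz /R_unchosen.
- by move=> a /sz /R_notin.
- have lt p : odd (dg R p) -> 1 + (all_ends P p + dg (unchosen sg) p) <= K.
    rewrite odd_rest => op; case: valid => _ _ _ /(_ p).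
    by rewrite add1n leq_eqVlt => /orP[/eqP Ep|//]; rewrite Ep (negbTE K_even) in op.
  move=> p; rewrite /trail_ends /=.
  case: (x =P p) => [<-|_]; first by rewrite (negbTE yx) addn0 => _; apply: lt.
  by case: (_ =P p) => [<-|_] // _; apply: lt; rewrite oddy.
Qed.

Hypothesis even_rest : forall x, ~~ odd (dg R x).

(** The load is now even and [K] is even, so any room is room for two ends, as the base of a closed
    trail requires. *)
Lemma room2 x : all_ends P x + dg (unchosen sg) x < K ->
  2 + (all_ends P x + dg (unchosen sg) x) <= K.
Proof.
move=> lt; have := even_rest x; rewrite odd_rest => ev.
rewrite add2n ltn_neqAle lt andbT; apply/eqP => E.
by move: K_even; rewrite -E /= (negbTE ev).
Qed.

(** When all degrees in [R] are even, a maximal trail can only stop where it started. *)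
Lemma closed_trail a : a \in R -> exists x z,
  [/\ last x z = x, 0 < size z, uniq (trail_edges (x, z)) & {subset trail_edges (x, z) <= R}].
Proof.
move=> aR; have /edgesP[x [y [cxy E]]] := subsetP R_edges _ aR.
have [z [uz sz stuck]] := longest_trail x R_edges.
exists x, z; split => //; last first.
  by case: (z) stuck => // /(_ _ aR); rewrite E set21 => /(_ isT).
apply/eqP; rewrite -[_ == _]negbK -(stuck_degree uz sz stuck); exact: even_rest.
Qed.

(** The closed trail is spliced into [t] at [y]; no end is created, so the loads stay as they
    were. *)
Lemma insert_closed_trail y z t : last y z = y -> 0 < size z -> uniq (trail_edges (y, z)) ->
  {subset trail_edges (y, z) <= R} -> t \in P -> y \in t.1 :: t.2 ->
  exists P', partial_trails sg P' /\ size (all_edges P) < size (all_edges P').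
Proof.
move=> lz z0 uz sz tP yt.
have [z1 [z2 [Et ly]]] : exists z1 z2, t.2 = z1 ++ z2 /\ last t.1 z1 = y.
  by case/splitPl: yt => z1 z2 l1; exists z1, z2.
pose t' := (t.1, z1 ++ z ++ z2); pose P' := t' :: rem t P.
have PP := perm_to_rem tP.
have eP' : perm_eq (all_edges P') (trail_edges (y, z) ++ all_edges P).
  have : perm_eq (trail_edges (y, z) ++ all_edges P)
      (trail_edges (y, z) ++ all_edges (t :: rem t P)).
    by rewrite perm_cat2l all_edges_perm.
  rewrite perm_sym => pp; apply: perm_trans pp.
  rewrite /P' !all_edges_cons catA perm_cat2r /t'.
  have -> : t = (t.1, z1 ++ z2) by case: (t) Et => /= ? ? ->.
  by rewrite /= !trail_edges_cat ly lz perm_catCA.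
have nP' x : all_ends P' x = all_ends P x.
  rewrite (all_ends_perm x PP) /P' !all_ends_cons /trail_ends /= Et.
  by rewrite !last_cat ly lz.
case: valid => sgc uP sP eP.
exists P'; split; last first.
  by rewrite (perm_size eP') size_cat size_pairmap -[X in X < _]add0n ltn_add2r.
split=> // [|b|x]; last by rewrite nP'.
  rewrite (perm_uniq eP') cat_uniq uz uP andbT /=.
  by apply/hasPn => b bP; apply/negP => /sz /R_notin; rewrite bP.
by rewrite (perm_mem eP') mem_cat => /orP[/sz /R_unchosen|/sP].
Qed.

Lemma on_trail y : 0 < all_ends P y -> exists2 t, t \in P & y \in t.1 :: t.2.
Proof.
case/all_ends_gt0=> t tP; rewrite /trail_ends addn_gt0 !lt0b => tw; exists t => //.
by case/orP: tw => /eqP <-; rewrite ?mem_head ?mem_last.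
Qed.

(* If the closed trail meets no vertex with spare degree and no other trail,
   exchanging [sg u] with the trail edge [uv] opens it up. *)
Lemma improve_swap u v z : u \in U -> last v z = u ->
  uniq (trail_edges (u, v :: z)) -> {subset trail_edges (u, v :: z) <= R} ->
  (forall y, y \in v :: z -> all_ends P y = 0 /\ dg (unchosen sg) y = K) ->
  exists sg' P', partial_trails sg' P' /\ size (all_edges P) < size (all_edges P').
Proof.
move=> uU lz /= /andP[uvz uz] sz full.
case: valid => sgc uP sP eP.
set w := sg u; have cuw : c u w := sgc u uU.
have uvR : [set u; v] \in R by apply: sz; rewrite mem_head.
have cuv : c u v by rewrite -mem_bip (subsetP R_edges).
have vU : v \notin U by have := cU cuv; rewrite uU; case: (v \in U).
have wU : w \notin U by have := cU cuw; rewrite uU; case: (w \in U).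
(* The chosen edge [uw] is one of the at most [K] edges at [w]. Hence [w] has spare degree and is
   not on the closed trail, whose vertices are all full. *)
have dw : dg (unchosen sg) w < K.
  apply: leq_trans (degW wU); rewrite -dg_bip.
  by apply: (@dg_unchosen _ u) => //; rewrite set22.
have wz : w \notin v :: z by apply/negP => /full[_ E]; rewrite E ltnn in dw.
have wv : w == v = false by move: wz; rewrite inE negb_or => /andP[/negbTE].
have uw : u == w = false by apply: contraNF wU => /eqP <-.
have uv : u == v = false by apply: contraNF vU => /eqP <-.
pose sg' x := if x == u then v else sg x.
have uwS : [set u; w] \notin unchosen sg.
  by rewrite inE negb_and negbK; apply/orP; left; apply: imset_f.
have uvS := R_unchosen uvR.
have S' : unchosen sg' = [set u; w] |: (unchosen sg :\ [set u; v]).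
  apply/setP => a; rewrite in_setU1 in_setD1.
  have other u' y y' : u' \in U -> y \notin U -> u' != u -> [set u; y] = [set u'; y'] -> False.
    move=> u'U yU nu E; have : u' \in [set u; y] by rewrite E set21.
    by rewrite !inE (negbTE nu) => /eqP E'; rewrite -E' u'U in yU.
  have [->|auw] /= := eqVneq a [set u; w].
    rewrite inE mem_bip cuw andbT; apply/imsetP => -[u' u'U].
    rewrite /sg'; case: eqP => [->|/eqP nu]; last exact: other.
    by move/set2_inj_l; rewrite uw => /(_ isT)/eqP; rewrite wv.
  have [->|auv] /= := eqVneq a [set u; v].
    rewrite inE; apply/negbTE; rewrite negb_and negbK; apply/orP; left.
    by apply/imsetP; exists u; rewrite // /sg' eqxx.
  rewrite !inE; congr (~~ _ && _); apply/imsetP/imsetP => -[u' u'U E].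
    exists u' => //; move: E; rewrite /sg'; case: eqP => // -> E.
    by rewrite E eqxx in auv.
  exists u' => //; move: E; rewrite /sg'; case: eqP => // -> E.
  by rewrite E eqxx in auw.
have dS x : dg (unchosen sg') x + (x \in [set u; v]) = dg (unchosen sg) x + (x \in [set u; w]).
  rewrite S' dg_setU1; last by rewrite inE negb_and uwS orbT.
  by rewrite (dg_setD1 x uvS); degree_lia.
have sgc' x : x \in U -> c x (sg' x).
  by rewrite /sg'; case: eqP => [->|_ /sgc].
have sub' a : a \in trail_edges (v, z) ++ [set u; w] :: all_edges P -> a \in unchosen sg'.
  rewrite S' in_setU1 in_setD1 mem_cat inE.
  case: eqP => //= _ /orP[aE|aP].
    rewrite R_unchosen ?andbT; last by apply: sz; rewrite inE aE orbT.
    by apply: contraNneq uvz => <-.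
  by rewrite sP // andbT; apply: contraNneq (R_notin uvR) => <-.
have uniq' : uniq (trail_edges (v, z) ++ [set u; w] :: all_edges P).
  rewrite cat_uniq uz /= uP andbT negb_or -andbA; apply/and3P; split.
  - by apply: contra uwS => aE; apply: R_unchosen; apply: sz; rewrite inE aE orbT.
  - apply/hasPn => b bP; apply/negP => bE; have : b \in R by apply: sz; rewrite inE bE orbT.
    by move/R_notin; rewrite bP.
  - by apply: contra uwS; apply: sP.
have v0 := full v (mem_head _ _); have u0 : all_ends P u = 0.
  by apply: (full u _).1; rewrite -lz mem_last.
have size' : size (all_edges P) < size (trail_edges (v, z) ++ [set u; w] :: all_edges P).
  by rewrite size_cat /= addnS ltnS leq_addl.
have suff' P' : perm_eq (all_edges P') (trail_edges (v, z) ++ [set u; w] :: all_edges P) ->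
    (forall x, all_ends P' x + dg (unchosen sg') x <= K) ->
    exists sg' P', partial_trails sg' P' /\ size (all_edges P) < size (all_edges P').
  move=> pp ee; exists sg', P'; split; last by rewrite (perm_size pp).
  split => //; first by rewrite (perm_uniq pp).
  by move=> a; rewrite (perm_mem pp); apply: sub'.
(* If [w] has room, the opened trail runs from [v] round to [u] and on to [w]. At [v] an unchosen
   edge is lost and an end gained; at [w] both grow by one, which [room2] allows. *)
have [lt|] := ltnP (all_ends P w + dg (unchosen sg) w) K.
  apply: (suff' ((v, rcons z w) :: P)).
    by rewrite all_edges_cons -cats1 trail_edges_cat lz -catA.
  move=> x; rewrite all_ends_cons /trail_ends /= last_rcons.
  have := dS x; rewrite !inE.
  have [->|xw] := eqVneq x w.
    by rewrite [v == w]eq_sym wv [w == u]eq_sym uw; have := room2 lt; degree_lia.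
  have [->|xv] := eqVneq x v.
    by rewrite [v == u]eq_sym uv v0.1 v0.2; degree_lia.
  by rewrite !orbF; have := eP x; degree_lia.
(* Otherwise some trail ends at [w], as the unchosen degree alone is below [K]. The opened trail is
   joined to it, so that [w] exchanges an end for an unchosen edge. *)
move=> ge; have E : all_ends P w + dg (unchosen sg) w = K.
  by apply/eqP; rewrite eqn_leq ge eP.
have w0 : 0 < all_ends P w by move: E dw; degree_lia.
have [l [P' [pp ee]]] := orient_trail w0.
apply: (suff' ((v, z ++ w :: l) :: P')).
  rewrite all_edges_cons trail_edges_cat lz /= -catA perm_cat2l /= perm_cons.
  by move: pp; rewrite all_edges_cons.
move=> x; have := ee x; rewrite !all_ends_cons /trail_ends /= last_cat /=.
have := dS x; have := eP x; rewrite !inE.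
have [->|xw] := eqVneq x w.
  by rewrite [v == w]eq_sym wv [w == u]eq_sym uw; degree_lia.
have [->|xv] := eqVneq x v.
  by rewrite [v == u]eq_sym uv v0.1 v0.2; degree_lia.
by rewrite !orbF; degree_lia.
Qed.

(** A closed trail of uncovered edges is added as a new trail based at a vertex with room, or
    spliced into a trail that it meets; if neither is possible, all its vertices are full and the
    swap applies at one of them in [U]. *)
Lemma improve_even a : a \in R ->
  exists sg' P', partial_trails sg' P' /\ size (all_edges P) < size (all_edges P').
Proof.
move=> aR; have [x [z [lz z0 uz sz]]] := closed_trail aR.
have rot y : y \in z -> exists z', [/\ last y z' = y, perm_eq z' z, 0 < size z',
    uniq (trail_edges (y, z')) & {subset trail_edges (y, z') <= R}].
  move=> yz; have [z' [l' p' e']] := rotate_closed_trail lz yz.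
  exists z'; split => //; rewrite ?(perm_size p') ?(perm_uniq e') // => b.
  by rewrite (perm_mem e'); apply: sz.
have [/hasP[y yz lt]|/hasPn noroom] :=
  boolP (has (fun y => all_ends P y + dg (unchosen sg) y < K) z).
  have [z' [l' p' s' u' b']] := rot y yz.
  have [||p|P' ?] := extend_partial_trails (t := (y, z')) valid s' u'.
  - by move=> b /b' /R_unchosen.
  - by move=> b /b' /R_notin.
  - rewrite /trail_ends /= l'; case: eqP => // <- _; exact: room2.
  by exists sg, P'.
have [/hasP[y yz /hasP[t tP yt]]|/hasPn nomeet] :=
  boolP (has (fun y => has (fun t => y \in t.1 :: t.2) P) z).
  have [z' [l' p' s' u' b']] := rot y yz.
  have [P' ?] := insert_closed_trail l' s' u' b' tP yt.
  by exists sg, P'.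
have full y : y \in z -> all_ends P y = 0 /\ dg (unchosen sg) y = K.
  move=> yz; have e0 : all_ends P y = 0.
    apply/eqP; rewrite -leqn0 leqNgt; apply/negP => /on_trail[t tP yt].
    by move/hasPn: (nomeet y yz) => /(_ t tP); rewrite yt.
  split=> //; apply/eqP; rewrite eqn_leq; case: valid => _ _ _ /(_ y).
  by have := noroom y yz; rewrite -leqNgt e0 add0n => -> ->.
have [u uU uz'] : exists2 u, u \in U & u \in z.
  case: (z) lz sz z0 => // y z' lz' sz' _.
  have xy : c x y by rewrite -mem_bip (subsetP R_edges) // sz' //= mem_head.
  case xU: (x \in U); first by exists x; rewrite // -[X in X \in _]lz' /= mem_last.
  by exists y; rewrite ?mem_head //; move: (cU xy); rewrite xU; case: (y \in U).
have [[|v z'] [l' p' // _ u' b']] := rot u uz'.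
apply: (@improve_swap u v z' uU l' u' b') => y; rewrite (perm_mem p'); exact: full.
Qed.

End Improve.

Lemma improve_trails sg P a : partial_trails sg P ->
  a \in unchosen sg -> a \notin all_edges P ->
  exists sg' P', partial_trails sg' P' /\ size (all_edges P) < size (all_edges P').
Proof.
move=> valid aS aP; pose R := [set a in unchosen sg | a \notin all_edges P].
have [/existsP[x ox]|/existsPn ev] := boolP [exists x, odd (dg R x)].
  by have [P' ?] := improve_odd valid ox; exists sg, P'.
by apply: (improve_even valid ev (a := a)); rewrite inE aS.
Qed.

(** Starting from any choice of edges and no trails, improvements are repeated; each one covers more
    edges, and there are at most [#|edges c|]. *)
Lemma covering_trails :
  exists sg P, partial_trails sg P /\ {subset unchosen sg <= all_edges P}.
Proof.
have [sg0 sg0c] : exists sg, forall u, u \in U -> c u (sg u).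
  (* The default is never reached on [U], where degrees are positive. *)
  exists (fun u => odflt u [pick y | c u y]) => u uU.
  case: pickP => //= none; have /andP[] := degU uU.
  by rewrite cardsE eq_card0.
have valid0 : partial_trails sg0 [::].
  split=> // x; rewrite /all_ends big_nil add0n.
  have [xU|xU] := boolP (x \in U).
    have /andP[_] := degU xU; rewrite -dg_bip => ub.
    rewrite -ltnS; apply: leq_trans ub.
    by apply: (@dg_unchosen _ x); rewrite ?sg0c ?set21.
  by apply: leq_trans (degW xU); rewrite -dg_bip dg_subset ?unchosen_edges.
suff: forall n sg P, #|edges c| - size (all_edges P) < n -> partial_trails sg P ->
    exists sg P, partial_trails sg P /\ {subset unchosen sg <= all_edges P}.
  by move=> /(_ _ sg0 [::] (ltnSn _)); apply.
elim=> // n IH sg P szn valid.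
have [/existsP[a /andP[aS aP]]|H] :=
  boolP [exists a, (a \in unchosen sg) && (a \notin all_edges P)].
  have [sg' [P' [valid' lt]]] := improve_trails valid aS aP.
  apply: (IH sg' P') => //.
  suff : size (all_edges P') <= #|edges c| by lia.
  case: valid' => _ /card_uniqP <- sP _; apply: subset_leq_card.
  by apply/subsetP => b /sP; apply: (subsetP (unchosen_edges _)).
exists sg, P; split => // a aS; apply: contraNT H => aP.
by apply/existsP; exists a; rewrite aS.
Qed.

(** The trails bound the number of unpaired edges at [x] by [K] minus its degree in [s], which turns
    the balance into bounds that mention only [K] and that degree. *)
Lemma bipartite_order : exists sg s,
  [/\ forall u, u \in U -> c u (sg u), uniq s, s =i unchosen sg,
      forall x, degree_in s x <= K &
      forall x, if x \in U then 2 * position_sum s x <= K * (size s).-1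
        else 2 * degree_in s x * (size s).-1 <=
             K * (size s).-1 + 2 * position_sum s x].
Proof.
have [sg [P [[sgc uP sP eP] cov]]] := covering_trails.
have [|s ps bal] := balanced_order (U := U) uP.
  by move=> a /sP /(subsetP (unchosen_edges _)) /edges_crossing.
have us : uniq s by rewrite (perm_uniq ps).
have ms : s =i unchosen sg.
  by move=> a; rewrite (perm_mem ps); apply/idP/idP; [apply: sP | apply: cov].
have ds x : degree_in s x = dg (unchosen sg) x.
  by rewrite degree_in_dg //; apply: eq_bigl => a; rewrite ms.
exists sg, s; split => // x.
  by rewrite ds; apply: leq_trans (eP x); rewrite leq_addl.
move: (bal x); case: ifP => xU b.
  by apply: leq_trans b _; rewrite leq_mul2r addnC ds eP orbT.
(* The balance inequality is increased by [degree_in s x * (size s).-1] on both sides; on the right,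
   ends and degree then add up to at most [K]. *)
rewrite mul2n -addnn mulnDl; apply: leq_trans (leq_add b (leqnn _)) _.
by rewrite addnAC -mulnDl leq_add2r leq_mul2r ds eP orbT.
Qed.

End Bipartite.

(** * Partial labellings that treat the vertices level by level *)

Lemma upper_arith p d k n h : (h = 0 -> p = 0 /\ d = 0) ->
  2 * p <= 2 * k * h.-1 -> d <= 2 * k ->
  2 * k * n + (p + d) <= k * (2 * n + 1 + h).
Proof.
case: h => [|h] d0 b dk; first by have [-> ->] := d0 erefl; lia.
move: b; rewrite /= !mulnDr -!mulnA; lia.
Qed.

(** For [h > 0] the bounds reduce the claim to [N + d < i + 2 * k]. For [h = 0] what is left is
    [N < i + k], which also needs [N <= i]. *)
Lemma lower_arith i P p d n h k N : (h = 0 -> p = 0 /\ d = 0) ->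
  d <= 2 * k -> N <= i -> N + d < i + 2 * k ->
  2 * d * h.-1 <= 2 * k * h.-1 + 2 * p ->
  i + 2 * k * (n + h + 1) + p <= P + d * h ->
  k * (2 * n + 1 + h) + N < P.
Proof.
case: h => [|h] d0 dk lab1 lab b.
  have [p0 dd] := d0 erefl; move: lab; rewrite p0 dd !mulnDr -!mulnA !muln0 !muln1; lia.
move: b; rewrite /= !mulnS -!mulnA !mulnDr -?mulnA ?muln1 ?mulnS; lia.
Qed.

Section Levels.
Variables (T : finType) (e : rel T) (K : nat).
Hypotheses (e_sym : symmetric e) (e_irr : irreflexive e).
Hypotheses (e_reg : regular e K.+1) (K_even : ~~ odd K) (K_gt0 : 0 < K).
Implicit Types (x y u v w : T) (A U : {set T}) (a : {set T}) (s : seq {set T}).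

(* Unlabelled edges count as [size s + 1], so that this sum can only grow when
   [s] is extended. *)
Definition partial_sum s x := \sum_(a in incident_edges e x) (index a s).+1.

Lemma incident_edgesP x a :
  reflect (exists2 y, e x y & a = [set x; y]) (a \in incident_edges e x).
Proof.
rewrite inE; apply: (iffP andP) => [[aE xa]|[y exy ->]].
  exact: edge_end aE xa.
by rewrite mem_edges // set21.
Qed.

Lemma card_incident_edges x : #|incident_edges e x| = K.+1.
Proof.
rewrite -(e_reg x) -dg_edges // /dg -sum1_card big_mkcond [RHS]big_mkcond /=.
by apply: eq_bigr => a _; rewrite inE; case: (a \in edges e); case: (x \in a).
Qed.

Lemma neighbour x : exists y, e x y.
Proof.
have : 0 < #|[set y | e x y]| by rewrite e_reg.
by rewrite card_gt0 => /set0Pn[y]; rewrite inE; exists y.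
Qed.

Lemma partial_sum_cat s1 s2 x : partial_sum s1 x <= partial_sum (s1 ++ s2) x.
Proof.
apply: leq_sum => a _; rewrite ltnS index_cat; case: ifP => // _.
exact: leq_trans (index_size a s1) (leq_addr _ _).
Qed.

Lemma partial_sum_cat_eq s1 s2 x : {subset incident_edges e x <= s1} ->
  partial_sum (s1 ++ s2) x = partial_sum s1 x.
Proof. by move=> sub; apply: eq_bigr => a /sub as1; rewrite index_cat as1. Qed.

(* The vertices of [A] are still to be treated. *)
Definition stage A s B :=
  [/\ uniq s, forall a, (a \in s) = (a \in edges e) && ~~ (a \subset A),
      forall x y, x \notin A -> y \notin A -> x != y -> partial_sum s x != partial_sum s y,
      forall x, x \notin A -> partial_sum s x <= B &
      forall x, x \in A -> B < partial_sum s x].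

Lemma stage_setT : stage setT [::] 0.
Proof.
split=> // [a|x y|x|x _]; rewrite ?inE ?subsetT ?andbF //.
apply: leq_trans (ltn0Sn K) _; rewrite -(card_incident_edges x) -sum1_card.
exact: leq_sum.
Qed.

Lemma stage_set0 s B : stage set0 s B -> antimagic e.
Proof.
case=> us ms inj _ _.
have msE a : (a \in s) = (a \in edges e).
  rewrite ms andb_idr // => /edgesP[x [y [_ ->]]].
  by apply/subsetPn; exists x; rewrite ?inE ?eqxx.
have sE : size s = #|edges e| by rewrite -(card_uniqP us); apply: eq_card => a; rewrite msE.
exists (fun a => (index a s).+1); split; last first.
  by move=> u v /eqP uv; apply/eqP; apply: inj; rewrite ?inE.
split=> [a b aE bE [] |j]; first by apply: index_inj; rewrite ?msE.
split=> [[a aE <-]|/andP[j0 jm]]; first by rewrite -sE index_mem msE aE.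
case: j j0 jm => // j _ jm; exists (nth set0 s j).
  by rewrite -msE mem_nth ?sE.
by rewrite index_uniq ?sE.
Qed.

(** This finishes the component of [w]. No edge joins [w] to the closed set [A], so all edges at [w]
    have labels, at most [size s], whereas the [K + 1] edges at a vertex of [A] are unlabelled and
    count [size s + 1] each. *)
Lemma stage_root A w s B : w \notin A ->
  (forall x y, x \in A -> e x y -> y \in A) ->
  stage (w |: A) s B -> stage A s (partial_sum s w).
Proof.
move=> wA closedA [us ms inj ub lb].
have eA x a : x \in A -> a \in incident_edges e x -> a \subset A.
  move=> xA /incident_edgesP[y exy ->].
  by rewrite subUset !sub1set xA (closedA x y).
have nA x : x \notin A -> x != w -> x \notin w |: A by rewrite !inE negb_or => -> ->.
have ltw x : x \notin A -> x != w -> partial_sum s x < partial_sum s w.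
  by move=> xA xw; apply: leq_ltn_trans (ub x (nA _ xA xw)) (lb w _); rewrite setU11.
split=> // [a|x y xA yA xy|x xA|x xA].
- rewrite ms; have [aE|//] := boolP (a \in edges e); congr (~~ _).
  apply/idP/idP => [aS|]; last by move/subset_trans; apply; apply: subsetUr.
  have [wa|wa] := boolP (w \in a); last first.
    apply/subsetP => x xa; have := subsetP aS x xa; rewrite !inE => /orP[/eqP xw|//].
    by rewrite -xw xa in wa.
  have [y ewy Ea] := edge_end e_sym aE wa.
  have : y \in w |: A by apply: (subsetP aS); rewrite Ea set22.
  rewrite !inE => /orP[/eqP yw|yA]; first by rewrite yw e_irr in ewy.
  by rewrite (closedA y w) // e_sym in wA.
- have [xw|xw] := eqVneq x w.
    by rewrite xw neq_ltn ltw ?orbT // -xw eq_sym.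
  have [->|yw] := eqVneq y w; first by rewrite neq_ltn ltw.
  by apply: inj; rewrite ?nA.
- by have [->|xw] := eqVneq x w; rewrite // ltnW // ltw.
- have xs a : a \in incident_edges e x -> index a s = size s.
    move=> ax; apply/eqP; rewrite eqn_leq index_size leqNgt index_mem ms.
    rewrite negb_and negbK (subset_trans (eA x a xA ax)) ?orbT //.
    exact: subsetUr.
  have -> : partial_sum s x = K.+1 * (size s).+1.
    rewrite -(card_incident_edges x) -sum_nat_const.
    by apply: eq_bigr => a /xs ->.
  rewrite -(card_incident_edges w) -sum_nat_const.
  have [a aw] : exists a, a \in incident_edges e w.
    have [y ewy] := neighbour w; exists [set w; y].
    by apply/incident_edgesP; exists y.
  rewrite /partial_sum (bigD1 a) //= [X in _ < X](bigD1 a) //= -addSn leq_add //.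
    rewrite ltnS index_mem ms; move/incident_edgesP: aw => [y ewy ->].
    rewrite mem_edges // ewy; apply/subsetPn; exists y; rewrite ?set22 //.
    rewrite !inE negb_or; apply/andP; split.
      by apply: contraTneq ewy => ->; rewrite e_irr.
    by apply: contra wA => yA; rewrite (closedA y w) // e_sym.
  by apply: leq_sum => b _; rewrite ltnS index_size.
Qed.


Definition between U A x y :=
  e x y && ((x \in U) && (y \in A) || (x \in A) && (y \in U)).

Lemma between_sym U A : symmetric (between U A).
Proof.
by move=> x y; rewrite /between e_sym orbC [(y \in A) && _]andbC [(y \in U) && _]andbC.
Qed.

(** * Labelling the edges of one level *)

Section Level.
Variables (A A1 : {set T}) (s : seq {set T}) (B : nat).
Hypotheses (A_sub : A \subset A1) (stageA1 : stage A1 s B).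
Hypothesis A_nbr : forall x y, x \in A -> e x y -> y \in A1.
Let U := A1 :\: A.
Variables (u0 : T) (sg : T -> T) (s2 : seq {set T}).
Hypothesis u0U : u0 \in U.
Hypothesis sgU : forall u, u \in U -> between U A u (sg u).
Hypothesis uniq_s2 : uniq s2.
Hypothesis mem_s2 : s2 =i unchosen (between U A) U sg.
Hypothesis deg_s2 : forall x, degree_in s2 x <= K.
Hypothesis bal_s2 : forall x,
  if x \in U then 2 * position_sum s2 x <= K * (size s2).-1
  else 2 * degree_in s2 x * (size s2).-1 <= K * (size s2).-1 + 2 * position_sum s2 x.
(** This provides at [v] an edge counted with at least the last label of the level: an edge inside
    [A], which is still unlabelled, or, if [v] is the root, the last chosen edge. *)
Hypothesis top_edge : forall v, v \in A ->
  (exists2 y, y \in A & e v y) \/ s2 = [::] /\ (forall u, u \in U -> sg u = v).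

Let s1 := s ++ enum [set a in edges e | a \subset U].
Let s' := s1 ++ s2.
(** The chosen edge is the only edge at [u] missing from [s'], and it counts [size s' + 1] for every
    [u]; the order is thus that of the sums of the other labels. *)
Let us := sort (fun x y => partial_sum s' x <= partial_sum s' y) (enum U).
Let s3 := [seq [set u; sg u] | u <- us].
Let S := s' ++ s3.

Let sgE u : u \in U -> e u (sg u) /\ sg u \in A.
Proof.
move=> uU; have /andP[-> /orP[/andP[_ ->]//|/andP[uA _]]] := sgU uU.
by move: uU; rewrite inE uA.
Qed.

Let mem_us u : (u \in us) = (u \in U).
Proof. by rewrite mem_sort mem_enum. Qed.

Let uniq_us : uniq us.
Proof. by rewrite sort_uniq enum_uniq. Qed.

Let UA x : x \in U -> x \in A = false.
Proof. by rewrite inE => /andP[/negbTE]. Qed.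

Let chosen_inj u y u' : u \in U -> y \in A -> u' \in U ->
  [set u; y] = [set u'; sg u'] -> u = u'.
Proof.
move=> uU yA u'U E; have : u \in [set u'; sg u'] by rewrite -E set21.
rewrite !inE => /orP[/eqP //|/eqP Eu].
by have [_] := sgE u'U; rewrite -Eu (UA uU).
Qed.

Let mem_s2_pair u y : u \in U -> y \in A ->
  ([set u; y] \in s2) = e u y && (y != sg u).
Proof.
move=> uU yA; rewrite mem_s2 inE mem_edges ?[in X in _ && X]/between; last 2 first.
- exact: between_sym.
- by move=> x; rewrite /between e_irr.
rewrite uU yA /= andbT andbC; congr (_ && ~~ _).
apply/imsetP/eqP => [[u' u'U E]|->]; last by exists u.
have Eu := chosen_inj uU yA u'U E; rewrite -Eu in E.
apply: (set2_inj_l _ E); by apply: contraTneq yA => <-; rewrite UA.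
Qed.

Let s2_pair a : a \in s2 -> exists u y, [/\ u \in U, y \in A, e u y & a = [set u; y]].
Proof.
rewrite mem_s2 inE => /andP[_ /edgesP[x [y [/andP[exy /orP[/andP[xU yA]|/andP[xA yU]]] ->]]]].
  by exists x, y.
by exists y, x; rewrite e_sym setUC.
Qed.

Let s3_pair a : a \in s3 -> exists2 u, u \in U & a = [set u; sg u].
Proof. by case/mapP=> u; rewrite mem_us => uU ->; exists u. Qed.

Let pair_sub u y : u \in U -> y \in A ->
  [set u; y] \subset A1 /\ ~~ ([set u; y] \subset U) /\ ~~ ([set u; y] \subset A).
Proof.
move=> uU yA; split; first by
  rewrite subUset !sub1set [y \in _](subsetP A_sub) // andbT; case/setDP: uU.
split; apply/subsetPn.
  by exists y; rewrite ?set22 // inE yA.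
by exists u; rewrite ?set21 // UA.
Qed.

Let mem_s a : (a \in s) = (a \in edges e) && ~~ (a \subset A1).
Proof. by case: stageA1. Qed.

Let mem_s1 a : (a \in s1) = (a \in edges e) && (~~ (a \subset A1) || (a \subset U)).
Proof. by rewrite mem_cat mem_s mem_enum inE andb_orr. Qed.

Let uniq_s1 : uniq s1.
Proof.
rewrite cat_uniq enum_uniq andbT; case: stageA1 => -> _ _ _ _ /=.
apply/hasPn => a; rewrite mem_enum inE mem_s => /andP[-> aU] /=.
by rewrite negbK (subset_trans aU) // subsetDl.
Qed.

Let pair_notin_s1 u y : u \in U -> y \in A -> [set u; y] \notin s1.
Proof.
move=> uU yA; have [aA1 [aU _]] := pair_sub uU yA.
by rewrite mem_s1 aA1 (negbTE aU) andbF.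
Qed.

Let chosen_notin u : u \in U -> [set u; sg u] \notin s'.
Proof.
move=> uU; have [_ sA] := sgE uU.
by rewrite mem_cat negb_or pair_notin_s1 // mem_s2_pair // eqxx andbF.
Qed.

Let uniq_s' : uniq s'.
Proof.
rewrite cat_uniq uniq_s1 uniq_s2 andbT /=; apply/hasPn => a.
by case/s2_pair=> u [y [uU yA _ ->]]; apply: pair_notin_s1.
Qed.

Let uniq_s3 : uniq s3.
Proof.
rewrite map_inj_in_uniq // => u u'; rewrite !mem_us => uU u'U.
by apply: chosen_inj => //; case: (sgE uU).
Qed.

Let uniq_S : uniq S.
Proof.
rewrite cat_uniq uniq_s' uniq_s3 andbT /=; apply/hasPn => a.
by case/s3_pair=> u uU ->; apply: chosen_notin.
Qed.

Let cross_in_S u y : u \in U -> y \in A -> e u y -> [set u; y] \in S.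
Proof.
move=> uU yA euy; rewrite !mem_cat mem_s2_pair // euy /=.
have [->|_] := eqVneq y (sg u); last by rewrite /= orbT.
by apply/orP; right; apply/mapP; exists u; rewrite ?mem_us.
Qed.

Let mem_S a : (a \in S) = (a \in edges e) && ~~ (a \subset A).
Proof.
have pairE u y : u \in U -> y \in A -> e u y ->
    ([set u; y] \in edges e) && ~~ ([set u; y] \subset A).
  by move=> uU yA euy; rewrite mem_edges // euy; case: (pair_sub uU yA) => _ [_].
apply/idP/idP.
  rewrite !mem_cat -mem_cat mem_s1.
  case/orP=> [/orP[/andP[aE aA]|/s2_pair[u [y [uU yA exy ->]]]]|/s3_pair[u uU ->]].
  - rewrite aE; case/orP: aA; first by apply: contra => /subset_trans; apply.
    move=> aU; have /edgesP[x [y [_ E]]] := aE; apply/subsetPn; exists x.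
      by rewrite E set21.
    by rewrite UA // (subsetP aU) // E set21.
  - exact: pairE.
  - by have [] := sgE uU => *; apply: pairE.
case/andP=> aE /subsetPn[x xa xA].
have [y exy Ea] := edge_end e_sym aE xa.
have [aA1|aA1] := boolP (a \subset A1); last by rewrite !mem_cat -mem_cat mem_s1 aE aA1.
have xU : x \in U by rewrite inE xA (subsetP aA1).
have [yA|yA] := boolP (y \in A); first by rewrite Ea cross_in_S.
have yU : y \in U by rewrite inE yA (subsetP aA1) // Ea set22.
by rewrite !mem_cat -mem_cat mem_s1 aE Ea [_ \subset U]subUset !sub1set xU yU orbT.
Qed.

Let K_half : K = 2 * K./2.
Proof. by rewrite -[LHS]odd_double_half (negbTE K_even) mul2n. Qed.

Let n1 := size s1.
Let h := size s2.
(** This threshold is [K] times the average label [n1 + (h + 1) / 2] of the block [s2], plus the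
    last label [size S]. *)
Let B' := K./2 * (2 * n1 + 1 + h) + size S.

Let size_S : size S = n1 + h + size us.
Proof. by rewrite (size_cat s') (size_cat s1) size_map. Qed.

Let index_s1 a : a \in s1 -> index a S < n1.
Proof. by move=> as1; rewrite /S /s' -catA index_cat as1 index_mem. Qed.

Let index_s2 a : a \in s2 -> index a S = n1 + index a s2.
Proof.
move=> as2; have [u [y [uU yA _ E]]] := s2_pair as2.
by rewrite /S /s' -catA index_cat {1}E (negbTE (pair_notin_s1 uU yA)) index_cat as2.
Qed.

Let index_high a : a \notin s1 -> a \notin s2 -> n1 + h <= index a S.
Proof.
move=> as1 as2; rewrite /S index_cat mem_cat (negbTE as1) (negbTE as2) /=.
by rewrite size_cat leq_addr.
Qed.

Let sum_s2 x (P : pred {set T}) (F : {set T} -> nat) :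
  (forall a, a \in s2 -> x \in a -> P a) ->
  \sum_(a in incident_edges e x | P a) (if a \in s2 then F a else 0) =
  \sum_(a <- s2 | x \in a) F a.
Proof.
move=> sP; rewrite -big_mkcondr big_mkcond [RHS]big_mkcond /= [RHS]big_uniq //=.
rewrite [RHS]big_mkcond /=; apply: eq_bigr => a _.
have [as2|] := boolP (a \in s2); last by rewrite andbF.
rewrite inE andbT; have -> : a \in edges e.
  by have [u [y [_ _ euy ->]]] := s2_pair as2; rewrite mem_edges.
by have [xa|_] := boolP (x \in a); rewrite // (sP a as2 xa).
Qed.

Let s2_nil : h = 0 -> s2 = [::].
Proof. by move/size0nil. Qed.

Let chosen_incident u : u \in U -> [set u; sg u] \in incident_edges e u.
Proof. by move=> uU; apply/incident_edgesP; exists (sg u); case: (sgE uU). Qed.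

Let other_incident u a : u \in U -> a \in incident_edges e u -> a != [set u; sg u] ->
  a \in s'.
Proof.
move=> uU au na; rewrite mem_cat mem_s1.
case/incident_edgesP: au => y euy E; have aE : a \in edges e by rewrite E mem_edges.
have uA1 : u \in A1 by case/setDP: uU.
rewrite aE /= E !subUset !sub1set uU uA1 /=.
have [yA1|//] := boolP (y \in A1); have [yA|yA] := boolP (y \in A); last first.
  by rewrite [y \in U]inE yA yA1.
by rewrite mem_s2_pair // euy /= (contraNneq _ na) ?orbT // => <-; rewrite E.
Qed.

(** Only the chosen edge changes its value, from [size s' + 1] to its label in [S], and the gain is
    the rank of [u] in [us]. *)
Let sum_U u : u \in U -> partial_sum S u = partial_sum s' u + index u us.
Proof.
move=> uU; have cu := chosen_incident uU.
rewrite /partial_sum (bigD1 _ cu) [in RHS](bigD1 _ cu) /=.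
rewrite (eq_bigr (fun a => (index a s').+1)); last first.
  by move=> a /andP[au na]; rewrite /S index_cat (other_incident uU au na).
rewrite addnAC; congr (_ + _).
rewrite /S index_cat (negbTE (chosen_notin uU)).
rewrite (memNindex (chosen_notin uU)) addSn; congr (_ + _).+1.
have -> : [set u; sg u] = nth set0 s3 (index u us).
  by rewrite (nth_map u) ?index_mem ?mem_us // nth_index ?mem_us.
by rewrite index_uniq // size_map index_mem mem_us.
Qed.

(** Along [us] the partial sums do not decrease, and the ranks added to them increase strictly. *)
Let sum_U_inj u v : u \in U -> v \in U -> u != v -> partial_sum S u != partial_sum S v.
Proof.
have lt x y : x \in U -> y \in U -> index x us < index y us -> partial_sum S x < partial_sum S y.
  move=> xU yU ixy; rewrite !sum_U // -addnS leq_add //.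
  apply: (sorted_ltn_index (leT := fun x y => partial_sum s' x <= partial_sum s' y)) ixy;
    rewrite ?mem_us //.
    by move=> ? ? ?; apply: leq_trans.
  by apply: sort_sorted => ? ?; apply: leq_total.
move=> uU vU uv; rewrite neq_ltn.
have [iuv|ivu|E] := ltngtP (index u us) (index v us).
- by rewrite lt.
- by rewrite [in X in _ || X]lt ?orbT.
by case/eqP: uv; rewrite -(nth_index u (s := us) (x := u)) ?mem_us // E nth_index ?mem_us.
Qed.

Let sum_U_le u : u \in U -> partial_sum S u <= B'.
Proof.
move=> uU; have cu := chosen_incident uU.
(* The chosen edge counts at most [size S]. Each of the other [K] edges counts at most [n1], or [n1]
   plus its position plus one if it lies in [s2]. *)
have : partial_sum S u <= size S + (K * n1 + (position_sum s2 u + degree_in s2 u)).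
  rewrite /partial_sum (bigD1 _ cu) /= leq_add //.
    have [eu sA] := sgE uU; have [_ [_ nA]] := pair_sub uU sA.
    by rewrite index_mem mem_S nA mem_edges // eu.
  have -> : K * n1 = \sum_(a in incident_edges e u | a != [set u; sg u]) n1.
    rewrite sum_nat_cond_const; congr (_ * _).
    have := card_incident_edges u; rewrite (cardD1 [set u; sg u]) cu => -[<-].
    by apply: eq_card => a; rewrite !inE andbC.
  have -> : position_sum s2 u + degree_in s2 u = \sum_(a <- s2 | u \in a) (index a s2 + 1).
    by rewrite big_split /= /degree_in sum1_count.
  rewrite -(@sum_s2 u (fun a => a != [set u; sg u])); last first.
    move=> a as2 _; apply: contraTneq as2 => ->; have := chosen_notin uU.
    by rewrite mem_cat negb_or => /andP[].
  rewrite -big_split /=; apply: leq_sum => a /andP[au na].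
  have := other_incident uU au na; rewrite mem_cat; case: ifP => [as2 _|_].
    by rewrite index_s2 // addn1 addnS.
  by rewrite orbF addn0 => /index_s1.
move/leq_trans; apply; rewrite /B' addnC leq_add2r.
have := bal_s2 u; rewrite uU => b; have d := deg_s2 u.
rewrite [in X in X <= _]K_half; rewrite K_half in b d.
apply: upper_arith b d => /s2_nil->; by rewrite /position_sum big_nil.
Qed.

Let sum_A_gt v : v \in A -> B' < partial_sum S v.
Proof.
move=> vA.
have av a : a \in incident_edges e v -> a \notin s1.
  case/incident_edgesP=> y evy ->; rewrite mem_s1 !subUset !sub1set.
  by rewrite (subsetP A_sub v vA) (A_nbr vA evy) /= inE vA andbF.
(* The strictness of the final comparison comes from the last clause: an unlabelled edge exceeds
   [size S] by one, and at the root the degree in [s2] is [0 < K]. *)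
have [a0 [a0v a0s lab1 lab2]] : exists a0, [/\ a0 \in incident_edges e v,
    a0 \notin s2, size S <= (index a0 S).+1 &
    size S + degree_in s2 v < (index a0 S).+1 + K].
  case: (top_edge vA) => [[y yA evy]|[s2E sgv]].
    exists [set v; y]; split.
    - by apply/incident_edgesP; exists y.
    - apply/negP => /s2_pair[u [w [uU wA _ E]]].
      have : u \in [set v; y] by rewrite E set21.
      by move: (UA uU); rewrite !inE => uA /orP[]/eqP uE; rewrite uE ?vA ?yA in uA.
    - by rewrite memNindex // mem_S mem_edges // evy /= negbK subUset !sub1set vA yA.
    - rewrite memNindex; first by rewrite addSn ltnS leq_add2l.
      by rewrite mem_S mem_edges // evy /= negbK subUset !sub1set vA yA.
  exists (last set0 s3).
  have us0 : 0 < size us.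
    by rewrite size_sort -cardE card_gt0; apply/set0Pn; exists u0.
  have s30 : 0 < size s3 by rewrite size_map.
  have ls : last set0 s3 \in s3 by case: (s3) s30 => //= a l _; rewrite mem_last.
  have lastS : (index (last set0 s3) S).+1 = size S.
    have -> : last set0 s3 = nth set0 S (size S).-1.
      by rewrite nth_last /S last_cat; case: (s3) s30.
    have S0 : 0 < size S by rewrite size_S (leq_trans us0) ?leq_addl.
    by rewrite index_uniq ?prednK.
  split.
  - have [u uU ->] := s3_pair ls; apply/incident_edgesP; exists u.
      by rewrite e_sym -(sgv u uU); case: (sgE uU).
    by rewrite sgv // setUC.
  - by rewrite s2E.
  - by rewrite lastS.
  - by rewrite lastS s2E /= addn0 -[X in X < _]addn0 ltn_add2l.
(* Every edge at [v] other than [a0] counts at least [n1 + h + 1], except that an edge of [s2] at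
   position [i] falls short by [h - i]. The shortfalls are written without subtraction. *)
have : (index a0 S).+1 + K * (n1 + h + 1) + position_sum s2 v <=
    partial_sum S v + degree_in s2 v * h.
  rewrite /partial_sum (bigD1 _ a0v) /= -addnA -[leqRHS]addnA leq_add2l.
  have -> : K * (n1 + h + 1) = \sum_(a in incident_edges e v | a != a0) (n1 + h + 1).
    rewrite sum_nat_cond_const; congr (_ * _).
    have := card_incident_edges v; rewrite (cardD1 a0) a0v => -[<-].
    by apply: eq_card => a; rewrite !inE andbC.
  have sP a : a \in s2 -> v \in a -> a != a0 by move=> as2 _; apply: contraTneq as2 => ->.
  have -> : degree_in s2 v * h = \sum_(a <- s2 | v \in a) h.
    by rewrite big_const_seq iter_addn_0 mulnC.
  rewrite /position_sum -!(sum_s2 _ sP) -!big_split /=; apply: leq_sum => a /andP[aI na].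
  case: ifP => as2; last by rewrite !addn0 addn1 ltnS index_high ?as2 ?av.
  by rewrite index_s2 //; move: (index a s2) (n1) (h); clear; lia.
move: (bal_s2 v) (deg_s2 v) lab1 lab2.
rewrite [v \in U]inE vA /= K_half => b d lab1 lab2.
apply: lower_arith d lab1 lab2 b => /s2_nil->.
by rewrite /position_sum big_nil.
Qed.

Lemma stage_level : stage A S B'.
Proof.
case: stageA1 => uniq_s _ inj ub lb.
have sumD x : x \notin A1 -> partial_sum S x = partial_sum s x.
  move=> xA1; rewrite /S /s' /s1 -!catA; apply: partial_sum_cat_eq => a.
  case/incident_edgesP=> y exy ->; rewrite mem_s mem_edges // exy /=.
  by apply/subsetPn; exists x; rewrite ?set21.
have ltU u : u \in U -> B < partial_sum S u.
  move=> uU; have /lb h1 : u \in A1 by case/setDP: uU.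
  apply: leq_trans h1 _; rewrite /S /s' /s1 -!catA; exact: partial_sum_cat.
have cover x : x \notin A -> x \notin A1 \/ x \in U.
  by rewrite [x \in U]inE => ->; case: (x \in A1); [right|left].
split=> //.
- move=> x y /cover[xA1|xU] /cover[yA1|yU] xy.
  + by rewrite !sumD //; apply: inj.
  + by rewrite neq_ltn (leq_ltn_trans _ (ltU y yU)) // sumD // ub.
  + by rewrite neq_ltn (leq_ltn_trans _ (ltU x xU)) ?orbT // sumD // ub.
  + exact: sum_U_inj.
- move=> x /cover[xA1|]; last exact: sum_U_le.
  rewrite sumD //; apply: leq_trans (ub x xA1) _.
  (* The sum at [u0] lies above the old threshold and not above the new one, so thresholds
     increase. *)
  by apply: ltnW; apply: leq_trans (ltU _ u0U) (sum_U_le u0U).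
Qed.

End Level.

(** * Induction over the levels and components *)

Definition no_isolated A := forall v, v \in A -> exists2 y, y \in A & e v y.

Definition closed_set A := forall x y, x \in A -> e x y -> y \in A.

(** Induction on the complement of [A], each stage coming from one for a larger set. If edges leave
    [A], its outside neighbours are added, and the new set has no isolated vertex; if [A] is closed
    but not everything, a vertex outside it is added as the root of another component. *)
Lemma exists_stage A :
  no_isolated A \/ (exists2 w, w \in A & closed_set (A :\ w)) ->
  exists s B, stage A s B.
Proof.
have [n] := ubnP #|~: A|; elim: n A => // n IH A /ltnSE szA condA.
have smaller A1 : A \proper A1 -> #|~: A1| < n.
  move=> AA1; apply: leq_trans szA; apply: proper_card.
  by rewrite properE !setCS -properE.
have [/existsP[x /andP[xA /existsP[y /andP[exy yA]]]]|H] :=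
  boolP [exists x, (x \in A) && [exists y, e x y && (y \notin A)]]; last first.
  have closedA : closed_set A.
    move=> x y xA exy; apply: contraNT H => yA.
    by apply/existsP; exists x; rewrite xA; apply/existsP; exists y; rewrite exy.
  have [->|AT] := eqVneq A setT; first by exists [::], 0; exact: stage_setT.
  have [w wA] : exists w, w \notin A.
    apply/existsP; apply: contraR AT; rewrite negb_exists => /forallP H'.
    by apply/eqP/setP => w; rewrite inE; apply/negPn.
  have [||s [B st]] := IH (w |: A).
  - by apply: smaller; apply: properUr; rewrite sub1set.
  - by right; exists w; rewrite ?setU11 // setU1K.
  by exists s, (partial_sum s w); apply: stage_root st.
pose A1 := A :|: [set y | [exists x, (x \in A) && e x y]].
have A_nbr v z : v \in A -> e v z -> z \in A1.
  move=> vA evz; rewrite !inE; apply/orP; right.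
  by apply/existsP; exists v; rewrite vA.
have A_sub : A \subset A1 by apply: subsetUl.
have U_nbr u : u \in A1 :\: A -> exists2 z, z \in A & e u z.
  rewrite !inE => /andP[/negbTE ->] /= /existsP[z /andP[zA ezu]].
  by exists z; rewrite // e_sym.
have yU : y \in A1 :\: A by rewrite inE yA (A_nbr x).
have [||s [B st]] := IH A1.
- apply: smaller; rewrite properE A_sub; apply/subsetPn; exists y => //.
  exact: A_nbr exy.
- left=> v vA1; have [vA|vA] := boolP (v \in A).
    by have [z evz] := neighbour v; exists z; rewrite ?(A_nbr v).
  have [|z zA evz] := U_nbr v; first by rewrite inE vA.
  by exists z; rewrite // (subsetP A_sub).
set U := A1 :\: A in yU U_nbr.
have UA z : z \in U -> z \notin A by case/setDP.
case: condA => [noiso|[w wA closedw]].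
- have [|||sg [s2 [sgU us2 ms2 ds2 bs2]]] :=
    @bipartite_order T (between U A) U K (between_sym U A) _ K_even.
  + move=> u v /andP[_ /orP[/andP[uU vA]|/andP[uA vU]]].
      by rewrite uU; apply/esym; apply: contraL vA; apply: UA.
    by rewrite vU; apply/negbTE; apply: contraL uA; apply: UA.
  + move=> u uU; apply/andP; split.
      have [z zA euz] := U_nbr u uU.
      by rewrite card_gt0; apply/set0Pn; exists z; rewrite inE /between euz uU zA.
    rewrite -(e_reg u); apply: subset_leq_card; apply/subsetP => z.
    by rewrite !inE => /andP[].
  (* One of the [K + 1] edges at [v] stays inside [A], which leaves at most [K] towards [U]. *)
  + move=> v vU; have [vA|vA] := boolP (v \in A).
      have [z zA evz] := noiso v vA.
      rewrite -ltnS -(e_reg v) (cardsD1 z [set y | e v y]) inE evz ltnS.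
      apply: subset_leq_card; apply/subsetP => y'; rewrite !inE /between.
      rewrite (negbTE vU) vA /= => /andP[-> y'U]; rewrite andbT.
      by apply: contraTneq y'U => ->; apply: contraL zA; apply: UA.
    rewrite (_ : [set _ | _] = set0) ?cards0 //; apply/setP => z.
    by rewrite !inE /between (negbTE vU) (negbTE vA) andbF.
  do 2 eexists; apply: (stage_level A_sub st A_nbr yU sgU us2 ms2 ds2 bs2).
  by move=> v /noiso; left.
(* Below the root the level is a star: [w] is the only vertex of [A] with neighbours in [U], so all
   edges between are chosen and the middle block is empty. *)
- have closedU u z : u \in U -> z \in A -> e u z -> z = w.
    move=> uU zA euz; apply/eqP; apply: contraT => zw.
    have : u \in A :\ w by apply: (closedw z); rewrite ?inE ?zw ?zA // e_sym.
    by rewrite inE (negbTE (UA u uU)) andbF.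
  have sgU u : u \in U -> between U A u w.
    move=> uU; have [z zA euz] := U_nbr u uU.
    by rewrite /between -{1}(closedU u z) // euz uU wA.
  do 2 eexists; apply: (stage_level (s2 := [::]) A_sub st A_nbr yU sgU) => //.
  + move=> a; apply/esym/negbTE; rewrite inE negb_and negbK.
    have [/edgesP[u [z [/andP[euz]]]]|] := boolP (a \in edges _); last by rewrite orbT.
    move=> H E; rewrite orbF; apply/imsetP.
    case/orP: H => /andP[uH zH].
      by exists u; rewrite // E (closedU u z).
    by exists z; rewrite // E setUC (closedU z u) // e_sym.
  + by move=> z; rewrite /= !muln0; case: ifP => _; rewrite /position_sum big_nil.
  + move=> v vA; have [->|vw] := eqVneq v w; first by right.
    left; have [z evz] := neighbour v; exists z => //.
    have : z \in A :\ w by apply: (closedw v); rewrite ?inE ?vw.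
    by rewrite inE => /andP[].
Qed.

End Levels.

Theorem mainTheorem1 (k : nat) (hodd : odd k) (hk : 3 <= k)
  (T : finType) (e : rel T) (e_sym : symmetric e) (e_irr : irreflexive e)
  (e_reg : regular e k) : antimagic e.
Proof.
case: k hodd hk e_reg => // K /= K_even K2 e_reg.
have K_gt0 : 0 < K by apply: ltnW.
have [|s [B st]] := exists_stage e_sym e_irr e_reg K_even K_gt0 (A := set0).
  by left=> v; rewrite inE.
exact: stage_set0 st.
Qed.
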